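(* Let $n\ge 0$ be an integer and $m=n+3$. Let $\bar{\bm A}\in SO(3)$, $\bar{\bm\omega},\bar{\bm a},\hat{\bm r}\in\mathbb{R}^3$ and $\hat{\bm\rho}_1,\dots,\hat{\bm\rho}_m\in\mathbb{R}^3$, and put $\hat{\bm p}_i=\bar{\bm A}^T(\hat{\bm\rho}_i-\hat{\bm r})$ for $i=1,\dots,m$. The landmarks $1,2,3$ are the three fixed (known) landmarks and the landmarks $4,\dots,m$ are the $n$ unknown ones. Assume $\hat{\bm p}_1\ne\hat{\bm p}_3$ and $\hat{\bm p}_2\neq\hat{\bm p}_3$, and define $$\bm e_i=\frac{\hat{\bm p}_i-\hat{\bm p}_3}{\|\hat{\bm p}_i-\hat{\bm p}_3\|}\quad(i=1,2),\qquad \bm\Pi=[\bm e_1\times]^2+[\bm e_2\times]^2\in\mathbb{R}^{3\times 3}.$$ Let $\bm F\in\mathbb{R}^{(15+3n)\times(15+3n)}$ and $\bm H\in\mathbb{R}^{3m\times(15+3n)}$ be the matrices of the linearized 3D SLAM system given in the context, and let $$\mathcal{O}=\begin{bmatrix}\bm H^T & (\bm H\bm F)^T & \cdots & (\bm H\bm F^{3n+14})^T\end{bmatrix}^T$$ be its observability matrix. If the three fixed landmarks are not placed on a straight line, i.e. $$\bm e_1\times\bm e_2\neq\bm 0,$$ then $\bm\Pi$ is full rank (rank $3$), and $\mathcal{O}$ is full rank, i.e. $\operatorname{rank}\mathcal{O}=3n+15$.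
   Context: For $\bm u\in\mathbb{R}^3$, $[\bm u\times]$ is the $3\times3$ skew-symmetric matrix with $[\bm u\times]\bm w=\bm u\times\bm w$ for all $\bm w\in\mathbb{R}^3$. $\bm 1_3$ and $\bm 0_3$ are the $3\times 3$ identity and zero matrices, and $\bm 0_{a\times b}$ is the $a\times b$ zero matrix. The (error) state of the linearized system is partitioned into blocks of size 3, in this order: attitude error, vehicle position, vehicle velocity, gyro bias, accelerometer bias, then the positions of the $n$ unknown landmarks $4,\dots,m$. Its dimension is $15+3n$. Here $\bar{\bm A}$ is the nominal rotation matrix of the vehicle, $\bar{\bm\omega}$ and $\bar{\bm a}$ are the nominal angular velocity and nominal acceleration, $\hat{\bm r}$ is the estimated vehicle position, $\hat{\bm\rho}_i$ is the position of landmark $i$ in the inertial frame, and $\hat{\bm p}_i$ is its position in the vehicle frame. The system matrix is, in $3\times 3$ blocks (the last block column has width $3n$), $$\bm F=\begin{bmatrix} -[\bar{\bm\omega}\times] & \bm 0_3 & \bm 0_3 & \tfrac12\bm 1_3 & \bm 0_3 & \bm 0_{3\times 3n}\\ \bm 0_3 & \bm 0_3 & \bm 1_3 & \bm 0_3 & \bm 0_3 & \bm 0_{3\times 3n}\\ -2\bar{\bm A}[\bar{\bm a}\times] & \bm 0_3 & \bm 0_3 & \bm 0_3 & \bar{\bm A} & \bm 0_{3\times 3n}\\ & & \bm 0_{(6+3n)\times(15+3n)} & & & \end{bmatrix}.$$ The observation sensitivity matrix $\bm H$ consists of $m$ block rows of height 3. For $i=1,2,3$ (known landmarks) the $i$-th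 block row is $$\begin{bmatrix}2[\hat{\bm p}_i\times] & -\bar{\bm A}^T & \bm 0_3 & \bm 0_3 & \bm 0_3 & \bm 0_{3\times 3n}\end{bmatrix}.$$ For $i=4,\dots,m$ (unknown landmarks) the $i$-th block row is $$\begin{bmatrix}2[\hat{\bm p}_i\times] & -\bar{\bm A}^T & \bm 0_3 & \bm 0_3 & \bm 0_3 & \bm 0_3 \;\cdots\; \bar{\bm A}^T\;\cdots\;\bm 0_3\end{bmatrix},$$ where $\bar{\bm A}^T$ in the last part occupies the $3\times3$ block corresponding to the position of landmark $i$ (the $(i-3)$-th of the last $n$ block columns). *)

(* Defs.v *)
From mathcomp Require Import all_boot all_order all_algebra.
From mathcomp Require Import reals.

Set Implicit Arguments.
Unset Strict Implicit.
Unset Printing Implicit Defensive.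

Import Order.TTheory GRing.Theory Num.Theory.
Local Open Scope ring_scope.

Section Space.
Variable R : realType.
Implicit Types (u v w : 'cV[R]_3) (A : 'M[R]_3).

(* The Euclidean norm; the library's norm on matrices is the sup norm. *)
Definition enorm u : R := Num.sqrt (\sum_(i < 3) u i 0 ^+ 2).

Definition normalized u : 'cV[R]_3 := (enorm u)^-1 *: u.

Definition rotation A : Prop := A^T *m A = 1%:M /\ \det A = 1.

Definition crossv u w : 'cV[R]_3 :=
  \col_(i < 3) nth 0 [:: u 1 0 * w 2 0 - u 2 0 * w 1 0;
                         u 2 0 * w 0 0 - u 0 0 * w 2 0;
                         u 0 0 * w 1 0 - u 1 0 * w 0 0] i.

Definition cross_mx u : 'M[R]_3 :=
  \matrix_(i < 3, j < 3)
    nth 0 (nth [::] [:: [:: 0; - u 2 0; u 1 0];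
                        [:: u 2 0; 0; - u 0 0];
                        [:: - u 1 0; u 0 0; 0]] i) j.

Lemma mul_cross_mx u w : cross_mx u *m w = crossv u w.
Proof.
have E0 : ord0 = 0 :> 'I_3 by apply/val_inj.
have E1 : lift ord0 ord0 = 1 :> 'I_3 by apply/val_inj.
have E2 : lift ord0 (lift ord0 ord0) = 2 :> 'I_3 by apply/val_inj.
apply/matrixP => i j; rewrite (ord1 j) !mxE !big_ord_recl big_ord0 addr0.
rewrite !mxE ?E0 ?E1 ?E2.
case: i => [[|[|[|//]]] ?] /=; rewrite mul0r !(mulNr, add0r, addr0) //.
- by rewrite addrC.
- by rewrite addrC.
Qed.

End Space.

Section System.
Variables (R : realType) (n : nat).
(* Nominal attitude, angular velocity and acceleration. *)
Variables (A : 'M[R]_3) (omega a : 'cV[R]_3).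
(* Landmark positions in the vehicle frame, the three known landmarks being
   the first three. *)
Variable p : 'I_(3 + n) -> 'cV[R]_3.

Lemma sum3E k : (\sum_(i < k) 3 = 3 * k)%N.
Proof. by rewrite sum_nat_const card_ord mulnC. Qed.

(* The first five block columns have width 3 and the sixth has width 3n;
   3 + (3 + (3 + (3 + (3 + 3 * n)))) is convertible to 15 + 3 * n. *)
Definition block_row h (B1 B2 B3 B4 B5 : 'M[R]_(h, 3)) (B6 : 'M[R]_(h, 3 * n)) :
    'M[R]_(h, 15 + 3 * n) :=
  row_mx B1 (row_mx B2 (row_mx B3 (row_mx B4 (row_mx B5 B6)))).

Definition sysF : 'M[R]_(15 + 3 * n) :=
  col_mx (block_row (- cross_mx omega) 0 0 (2^-1 *: 1%:M) 0 0)
 (col_mx (block_row 0 0 1%:M 0 0 0)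
 (col_mx (block_row (- (2 *: (A *m cross_mx a))) 0 0 0 A 0)
         (0 : 'M[R]_(6 + 3 * n, 15 + 3 * n)))).

Definition landmark_cols (i : 'I_(3 + n)) : 'M[R]_(3, 3 * n) :=
  match split i with
  | inl _ => 0
  | inr j => castmx (erefl 3, sum3E n)
               (\mxrow_(k < n) (if k == j then A^T else 0 : 'M[R]_3))
  end.

Definition sysH_row (i : 'I_(3 + n)) : 'M[R]_(3, 15 + 3 * n) :=
  block_row (2 *: cross_mx (p i)) (- A^T) 0 0 0 (landmark_cols i).

Definition sysH : 'M[R]_(3 * (3 + n), 15 + 3 * n) :=
  castmx (sum3E (3 + n), erefl (15 + 3 * n)%N) (\mxcol_(i < 3 + n) sysH_row i).

End System.

Definition observability_mx (R : realType) (N q : nat)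
    (F : 'M[R]_N) (H : 'M[R]_(q, N)) : 'M[R]_(\sum_(k < N) q, N) :=
  \mxcol_(k < N) (H *m F ^+ k).

(* Main.v *)
Require Import Defs.
From mathcomp Require Import all_boot all_order all_algebra.
From mathcomp Require Import reals.

(* Writing * for the cross product, [Pi] is injective because
   x^T Pi x = - |e1 * x|^2 - |e2 * x|^2 and a vector parallel to two
   independent vectors is zero. For the observability matrix,
   the differences of the known-landmark rows of H x = 0 give
   (p_i - p_3) * theta = 0 for i = 1, 2, so that ker H consists of the states
   whose attitude, position and landmark components vanish. Then H F x = 0
   kills the velocity and the gyro bias, and H F^2 x = 0 the accelerometer
   bias, so three blocks of the observability matrix already suffice. *)

Set Implicit Arguments.
Unset Strict Implicit.
Unset Printing Implicit Defensive.

Import Order.TTheory GRing.Theory Num.Theory.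
Local Open Scope ring_scope.

Lemma rank_full_inj (K : fieldType) q k (M : 'M[K]_(q, k)) :
  (forall x : 'cV_k, M *m x = 0 -> x = 0) -> \rank M = k.
Proof.
move=> inj; rewrite -mxrank_tr; apply/eqP/inj_row_free => v vM0.
apply: trmx_inj; rewrite trmx0; apply: inj.
by rewrite -[M]trmxK -trmx_mul vM0 trmx0.
Qed.

Lemma trmx_mul_self_eq0 (K : realDomainType) k (v : 'cV[K]_k) :
  v^T *m v = 0 -> v = 0.
Proof.
move=> /matrixP/(_ 0 0); rewrite !mxE.
under eq_bigr do rewrite mxE -expr2.
move/(psumr_eq0P (fun i _ => sqr_ge0 (v i 0))) => z.
by apply/colP => i; rewrite mxE; apply/eqP; rewrite -sqrf_eq0 z.
Qed.

Section Cross.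
Variable R : realType.
Implicit Types u w x : 'cV[R]_3.

Lemma cross_mxZ (c : R) u : cross_mx (c *: u) = c *: cross_mx u.
Proof.
apply/matrixP => -[[|[|[|//]]] ?] [[|[|[|//]]] ?];
  by rewrite !mxE /= ?mulr0 ?mulrN.
Qed.

Lemma cross_mxB u w : cross_mx (u - w) = cross_mx u - cross_mx w.
Proof.
apply/matrixP => -[[|[|[|//]]] ?] [[|[|[|//]]] ?];
  by rewrite !mxE /= ?subr0 // opprD.
Qed.

Lemma tr_cross_mx u : (cross_mx u)^T = - cross_mx u.
Proof.
apply/matrixP => -[[|[|[|//]]] ?] [[|[|[|//]]] ?];
  by rewrite !mxE /= ?oppr0 ?opprK.
Qed.

(** All 2x2 minors appear here, with uniform indices, so that later arguments need no case analysis
    on coordinates. *)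
Lemma crossv_eq0P u w :
  reflect (forall i j, u i 0 * w j 0 = u j 0 * w i 0) (crossv u w == 0).
Proof.
apply: (iffP eqP) => [/colP z|z]; last first.
  by apply/colP => -[[|[|[|//]]] ?]; rewrite !mxE /= z subrr.
have z12 := z 0; have z20 := z 1; have z01 := z 2.
rewrite !mxE /= in z12 z20 z01.
move/subr0_eq in z12; move/subr0_eq in z20; move/subr0_eq in z01.
have ordE (i : 'I_3) : [\/ i = 0, i = 1 | i = 2].
  case: i => [[|[|[|//]]] ?].
  - by constructor 1; apply/val_inj.
  - by constructor 2; apply/val_inj.
  - by constructor 3; apply/val_inj.
by move=> i j; case: (ordE i) => ->; case: (ordE j) => ->.
Qed.

(* Each [x_k^2] times a 2x2 minor of [u, w] vanishes because the minors of
   [u, x] and [w, x] do. *)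
Lemma cross_mx_inj u w x : crossv u w <> 0 ->
  cross_mx u *m x = 0 -> cross_mx w *m x = 0 -> x = 0.
Proof.
rewrite !mul_cross_mx => uw0 /eqP/crossv_eq0P ux /eqP/crossv_eq0P wx.
apply/colP => k; rewrite [RHS]mxE; apply/eqP/negP => /negP xk0.
apply: uw0; apply/eqP/crossv_eq0P => i j.
apply: (mulIf (mulf_neq0 xk0 xk0)).
by rewrite mulrACA (ux i k) (wx j k) [RHS]mulrACA (ux j k) (wx i k) mulrACA
  [RHS]mulrACA [x j 0 * _]mulrC.
Qed.

Lemma crossvZ (c d : R) u w : crossv (c *: u) (d *: w) = (c * d) *: crossv u w.
Proof.
by rewrite -!mul_cross_mx cross_mxZ -scalemxAl -scalemxAr scalerA.
Qed.

(* [\rank] opens the scope %MS, where + is the sum of row spaces; hence %R. *)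
Lemma rank_cross_sqrD u w : crossv u w <> 0 ->
  \rank (cross_mx u ^+ 2 + cross_mx w ^+ 2)%R = 3%N.
Proof.
move=> uw0; apply: rank_full_inj => x.
have sqE v : x^T *m (cross_mx v ^+ 2 *m x) =
    - ((cross_mx v *m x)^T *m (cross_mx v *m x)).
  by rewrite expr2 trmx_mul tr_cross_mx mulmxN mulNmx opprK !mulmxA.
rewrite mulmxDl => /(congr1 (mulmx x^T)); rewrite mulmx0 mulmxDr !sqE -opprD.
(* The two squared norms add up to that of the stacked vector, so definiteness is applied only
   once. *)
rewrite -mul_row_col -tr_col_mx => /eqP; rewrite oppr_eq0.
move=> /eqP/trmx_mul_self_eq0/eqP; rewrite col_mx_eq0 => /andP[/eqP ux /eqP wx].
exact: cross_mx_inj uw0 ux wx.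
Qed.
End Cross.

Section State.
Variables (R : realType) (n : nat).

(** Components: attitude [t], position [s], velocity [v], gyro bias [b], accelerometer bias [c],
    landmarks [l]. *)
Definition block_col (t s v b c : 'cV[R]_3) (l : 'cV[R]_(3 * n)) :
    'cV[R]_(15 + 3 * n) :=
  col_mx t (col_mx s (col_mx v (col_mx b (col_mx c l)))).

Variant block_col_spec : 'cV[R]_(15 + 3 * n) -> Prop :=
  BlockCol t s v b c l : block_col_spec (block_col t s v b c l).

Lemma block_colP x : block_col_spec x.
Proof.
(* The sizes are explicit because [15 + 3 * n] is a nested sum only up to conversion. *)
rewrite -[x](@vsubmxK _ 3 (3 + (3 + (3 + (3 + 3 * n))))).
rewrite -[dsubmx _](@vsubmxK _ 3 (3 + (3 + (3 + 3 * n)))).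
rewrite -[dsubmx (dsubmx _)](@vsubmxK _ 3 (3 + (3 + 3 * n))).
rewrite -[dsubmx (dsubmx (dsubmx _))](@vsubmxK _ 3 (3 + 3 * n)).
rewrite -[dsubmx (dsubmx (dsubmx (dsubmx _)))](@vsubmxK _ 3 (3 * n)).
exact: BlockCol.
Qed.

Lemma mul_block_row_col h (B1 B2 B3 B4 B5 : 'M[R]_(h, 3)) B6 t s v b c l :
  block_row B1 B2 B3 B4 B5 B6 *m block_col t s v b c l =
  B1 *m t + B2 *m s + B3 *m v + B4 *m b + B5 *m c + B6 *m l.
Proof.
rewrite /block_row /block_col.
rewrite (@mul_row_col _ h 3 (3 + (3 + (3 + (3 + 3 * n))))).
rewrite (@mul_row_col _ h 3 (3 + (3 + (3 + 3 * n)))).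
rewrite (@mul_row_col _ h 3 (3 + (3 + 3 * n))).
by rewrite !mul_row_col !addrA.
Qed.

Lemma mul_sysF (A : 'M[R]_3) omega a t s v b c l :
  sysF n A omega a *m block_col t s v b c l =
  block_col (- cross_mx omega *m t + 2^-1 *: b) v
    (- (2 *: (A *m cross_mx a)) *m t + A *m c) 0 0 0.
Proof.
rewrite /sysF (@mul_col_mx _ 3 (3 + (3 + (6 + 3 * n)))).
rewrite (@mul_col_mx _ 3 (3 + (6 + 3 * n))) (@mul_col_mx _ 3 (6 + 3 * n)).
rewrite !mul_block_row_col !mul0mx !addr0 !add0r mul1mx.
(* The single zero block of height [6 + 3 * n] is matched with the zero bias and landmark
   components. *)
by rewrite -scalemxAl mul1mx /block_col !col_mx0.
Qed.

Lemma mul_landmark_cols (A : 'M[R]_3) (C : 'I_n -> 'cV[R]_3) j :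
  landmark_cols A (rshift 3 j) *m castmx (sum3E n, erefl 1%N) (\mxcol_k C k) =
  A^T *m C j.
Proof.
rewrite /landmark_cols -[rshift 3 j]/(unsplit (inr j)) unsplitK.
(* Destructing the size equation turns both casts into identities. *)
case: _ / (sum3E n); rewrite !castmx_id mul_mxrow_mxcol.
rewrite (bigD1 j) //= eqxx big1 ?addr0 // => k /negPf->.
by rewrite mul0mx.
Qed.

Lemma mul_sysH_eq0 (A : 'M[R]_3) p (x : 'cV_(15 + 3 * n)) :
  sysH A p *m x = 0 -> forall i, sysH_row A p i *m x = 0.
Proof.
rewrite /sysH; case: _ / (sum3E (3 + n)); rewrite castmx_id mxcol_mul => z i.
by rewrite -[LHS](mxcolK (fun i => sysH_row A p i *m x)) z submxcol0.
Qed.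

(** The components [v], [b], [c] are arbitrary, so this applies in turn to [x], [F x] and
    [F^2 x]. *)
Lemma ker_sysH (A : 'M[R]_3) (p : 'I_(3 + n) -> 'cV[R]_3) t s v b c l :
  let p_ i := p (lshift n (i : 'I_3)) in
  A^T *m A = 1%:M -> crossv (p_ 0 - p_ 2) (p_ 1 - p_ 2) <> 0 ->
  sysH A p *m block_col t s v b c l = 0 -> [/\ t = 0, s = 0 & l = 0].
Proof.
move=> p_ AA noncol /mul_sysH_eq0 Hx0.
have ATinj y : A^T *m y = 0 -> y = 0.
  by move=> z; rewrite -[y]mul1mx -(mulmx1C AA) -mulmxA z mulmx0.
have eqn i : 2 *: (cross_mx (p i) *m t) - A^T *m s + landmark_cols A i *m l = 0.
  have := Hx0 i; rewrite /sysH_row mul_block_row_col !mul0mx !addr0.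
  by rewrite mulNmx -scalemxAl.
have eqn_known i : 2 *: (cross_mx (p_ i) *m t) = A^T *m s.
  apply/subr0_eq; rewrite -[RHS](eqn (lshift n i)) /landmark_cols.
  by rewrite -[lshift n i]/(unsplit (inl i)) unsplitK mul0mx addr0.
have crossB i : cross_mx (p_ i - p_ 2) *m t = 0.
  rewrite cross_mxB mulmxBl; apply/eqP.
  have two_neq0 : 2 != 0 :> R by rewrite pnatr_eq0.
  by rewrite subr_eq0 -(inj_eq (scalerI two_neq0)) !eqn_known.
have t0 : t = 0 by apply: cross_mx_inj noncol (crossB _) (crossB _).
have s0 : s = 0 by apply: ATinj; rewrite -(eqn_known 0) t0 mulmx0 scaler0.
split=> //.
(* [C j] is the block of [l] for the [j]-th unknown landmark; as [t] and [s] vanish, its row of [H]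
   reduces to [A^T *m C j = 0]. *)
pose C (j : 'I_n) : 'cV[R]_3 :=
  submxcol (castmx (esym (sum3E n), erefl 1%N) l) j.
have lE : l = castmx (sum3E n, erefl 1%N) (\mxcol_j C j).
  by rewrite submxcolK castmxKV.
have C0 j : C j = 0.
  apply: ATinj; rewrite -mul_landmark_cols -lE -[RHS](eqn (rshift 3 j)).
  by rewrite t0 s0 !mulmx0 scaler0 subr0 add0r.
by rewrite lE; under eq_mxcol do rewrite C0; rewrite mxcol0 castmx_const.
Qed.

End State.

Lemma mul_observability_mx_eq0 (R : realType) N q (F : 'M[R]_N) (H : 'M_(q, N))
    (x : 'cV_N) :
  observability_mx F H *m x = 0 ->
  forall k, (k < N)%N -> H *m (F ^+ k *m x) = 0.
Proof.
rewrite /observability_mx mxcol_mul => z k ltkN.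
have := mxcolK (fun k : 'I_N => H *m F ^+ k *m x) (Ordinal ltkN).
by rewrite z submxcol0 mulmxA => ->.
Qed.

Theorem proposition1 (R : realType) (n : nat)
    (A : 'M[R]_3) (omega a r : 'cV[R]_3) (rho : 'I_(3 + n) -> 'cV[R]_3) :
  let p := fun i : 'I_(3 + n) => A^T *m (rho i - r) in
  let p1 := p (lshift n (0 : 'I_3)) in
  let p2 := p (lshift n (1 : 'I_3)) in
  let p3 := p (lshift n (2 : 'I_3)) in
  let e1 := normalized (p1 - p3) in
  let e2 := normalized (p2 - p3) in
  let Pi := cross_mx e1 ^+ 2 + cross_mx e2 ^+ 2 in
  let F := sysF n A omega a in
  let H := sysH A p in
  rotation A -> p1 <> p3 -> p2 <> p3 ->
  crossv e1 e2 <> 0 ->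
  \rank Pi = 3%N /\ \rank (observability_mx F H) = (3 * n + 15)%N.
Proof.
move=> p p1 p2 p3 e1 e2 Pi F H [AA _] _ _ e12; split.
  exact: rank_cross_sqrD.
(* By bilinearity, [crossv e1 e2] is a scalar multiple of this cross product. *)
have noncol : crossv (p1 - p3) (p2 - p3) <> 0.
  by move=> z; apply: e12; rewrite crossvZ z scaler0.
rewrite [RHS]addnC; apply: rank_full_inj => x /mul_observability_mx_eq0 Ox0.
(* The powers 0, 1, 2 occur for every [n]: the bound [k < 15 + 3 * n] holds by computation. *)
have HF0 : H *m x = 0 by rewrite -[x]mul1mx; apply: (Ox0 0).
have HF1 : H *m (F *m x) = 0 by apply: (Ox0 1).
have HF2 : H *m (F *m (F *m x)) = 0.
  by rewrite [F *m (F *m x)]mulmxA; apply: (Ox0 2).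
case: (block_colP x) => [t s v b c l] in HF0 HF1 HF2 *.
have [t0 s0 l0] := ker_sysH AA noncol HF0; subst t s l.
rewrite mul_sysF in HF1 HF2.
(* Now [F x] has attitude [b / 2], position [v] and velocity [A c]; the last becomes the position
   component of [F^2 x]. *)
have [b0 v0 _] := ker_sysH AA noncol HF1.
rewrite mul_sysF in HF2.
have [_ c0 _] := ker_sysH AA noncol HF2.
rewrite !mulmx0 !add0r in b0 c0.
move/eqP: b0; rewrite scaler_eq0 invr_eq0 pnatr_eq0 /= => /eqP b0.
have {}c0 : c = 0 by rewrite -[c]mul1mx -AA -mulmxA c0 mulmx0.
by rewrite /block_col b0 c0 v0 !col_mx0.
Qed.
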